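(* Let $\mathbf{k}$ be an algebraically closed field of characteristic $0$, let $V$ be a $4$-dimensional $\mathbf{k}$-vector space with basis $\{e_1,e_2,e_3,e_4\}$, and let $\Gamma=C_4$ be the cycle graph on the vertices $1,2,3,4$, with edges $(1,2),(2,3),(3,4),(1,4)$. Then there exists no non-monomial linear subspace $K\subseteq\bigwedge^2V$ such that $\mathcal{R}_\Gamma=\mathcal{R}(V,K)$ (equality of subsets of $V^\vee$).
   Context: For a linear subspace $K\subseteq\bigwedge^2V$, let $K^\perp=(\bigwedge^2V/K)^\vee\subseteq\bigwedge^2V^\vee$ be the space of skew-symmetric bilinear forms on $V$ vanishing on $K$. The resonance variety is $\mathcal{R}(V,K)=\{a\in V^\vee:\exists\, b\in V^\vee\text{ such that }0\ne a\wedge b\in K^\perp\}\cup\{0\}$, considered with its reduced structure. $\mathcal{R}_\Gamma=\mathcal{R}(V,K_\Gamma)$, where $K_\Gamma\subseteq\bigwedge^2V$ is the span of all $e_i\wedge e_j$ with $(i,j)$ an edge of $\Gamma$. A subspace $K\subseteq\bigwedge^2V$ is called monomial if there exists a basis $\{v_1,\dots,v_4\}$ of $V$ such that $K$ is generated by elements of the form $v_i\wedge v_j$; otherwise it is non-monomial. *)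

(* Defs.v *)
From HB Require Import structures.
From mathcomp Require Import all_boot all_order all_algebra.

Set Implicit Arguments.
Unset Strict Implicit.
Unset Printing Implicit Defensive.

Import GRing.Theory.
Local Open Scope ring_scope.

(* The exterior square of a finite-dimensional space V is realised as the     *)
(* dual of the space of skew-symmetric bilinear forms on V, with x /\ y the   *)
(* evaluation of forms at (x, y). Outside characteristic 2 this is the usual  *)
(* exterior square: see wedge_alternating and ext2_universal below.           *)

Section ExteriorSquare.

Variables (F : fieldType) (V : vectType F).
Implicit Types (w : 'Hom(V, 'Hom(V, F^o))) (x y : V).

Definition swap_form_at w y (x : V) : F^o := w x y.

Fact swap_form_at_is_linear w y : linear (swap_form_at w y).
Proof. by move=> c x z; rewrite /swap_form_at linearP !lfunE /= scale_lfunE. Qed.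
HB.instance Definition _ w y := GRing.isLinear.Build F V F^o _
  (swap_form_at w y) (swap_form_at_is_linear w y).

Definition swap_form_fun w y : 'Hom(V, F^o) := linfun (swap_form_at w y).

Fact swap_form_fun_is_linear w : linear (swap_form_fun w).
Proof.
move=> c y z; apply/lfunP=> x.
by rewrite add_lfunE scale_lfunE !lfunE /= /swap_form_at linearP.
Qed.
HB.instance Definition _ w := GRing.isLinear.Build F V 'Hom(V, F^o) _
  (swap_form_fun w) (swap_form_fun_is_linear w).

Definition swap_form w : 'Hom(V, 'Hom(V, F^o)) := linfun (swap_form_fun w).

Lemma swap_formE w x y : swap_form w x y = w y x.
Proof. by rewrite !lfunE. Qed.

Definition symmetrization w := w + swap_form w.

Fact symmetrization_is_linear : linear symmetrization.
Proof.
move=> c w1 w2; apply/lfunP=> x; apply/lfunP=> y.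
by rewrite !(add_lfunE, scale_lfunE, swap_formE) scalerDr addrACA.
Qed.
HB.instance Definition _ := GRing.isLinear.Build F
  'Hom(V, 'Hom(V, F^o)) 'Hom(V, 'Hom(V, F^o)) _
  symmetrization symmetrization_is_linear.

Definition skew_forms : {vspace 'Hom(V, 'Hom(V, F^o))} :=
  lker (linfun symmetrization).

Lemma skew_formsP w :
  reflect (forall x y, w x y = - w y x) (w \in skew_forms).
Proof.
rewrite memv_ker lfunE; apply: (iffP eqP) => [w0 x y | wN].
  apply/eqP; rewrite -addr_eq0 -(swap_formE w x y) -!add_lfunE.
  by have /lfunP/(_ x)/lfunP/(_ y)/= := w0; rewrite !zero_lfunE /symmetrization => ->.
apply/lfunP=> x; apply/lfunP=> y.
by rewrite !add_lfunE swap_formE (wN x y) addNr !zero_lfunE.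
Qed.

Definition skew_form : vectType F := subvs_of skew_forms.

Definition ext2 : vectType F := 'Hom(skew_form, F^o).

Definition wedge_at x y (w : skew_form) : F^o := vsval w x y.

Fact wedge_at_is_linear x y : linear (wedge_at x y).
Proof.
by move=> c w1 w2; rewrite /wedge_at linearP !(add_lfunE, scale_lfunE).
Qed.
HB.instance Definition _ x y := GRing.isLinear.Build F skew_form F^o _
  (wedge_at x y) (wedge_at_is_linear x y).

Definition wedge x y : ext2 := linfun (wedge_at x y).

Lemma wedgeE x y (w : skew_form) : wedge x y w = vsval w x y.
Proof. exact: lfunE. Qed.

Definition dwedge_at (a b : 'Hom(V, F^o)) x y : F^o := a x * b y - a y * b x.

Fact dwedge_at_is_linear a b x : linear (dwedge_at a b x).
Proof.
move=> c y z; rewrite /dwedge_at.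
have -> : a (c *: y + z) = c * a y + a z by exact: linearP.
have -> : b (c *: y + z) = c * b y + b z by exact: linearP.
rewrite mulrDr mulrDl opprD addrACA [a x * _]mulrCA -[c * _ * _]mulrA -mulrBr.
by [].
Qed.
HB.instance Definition _ a b x := GRing.isLinear.Build F V F^o _
  (dwedge_at a b x) (dwedge_at_is_linear a b x).

Definition dwedge_fun a b x : 'Hom(V, F^o) := linfun (dwedge_at a b x).

Fact dwedge_fun_is_linear a b : linear (dwedge_fun a b).
Proof.
move=> c x z; apply/lfunP=> y; rewrite add_lfunE scale_lfunE !lfunE /=.
rewrite /dwedge_at.
have -> : a (c *: x + z) = c * a x + a z by exact: linearP.
have -> : b (c *: x + z) = c * b x + b z by exact: linearP.
rewrite mulrDr mulrDl opprD addrACA [a y * _]mulrCA -[c * _ * _]mulrA -mulrBr.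
by [].
Qed.
HB.instance Definition _ a b := GRing.isLinear.Build F V 'Hom(V, F^o) _
  (dwedge_fun a b) (dwedge_fun_is_linear a b).

Fact dwedge_skew a b : linfun (dwedge_fun a b) \in skew_forms.
Proof.
by apply/skew_formsP=> x y; rewrite !lfunE /= /dwedge_at opprB.
Qed.

Definition dwedge (a b : 'Hom(V, F^o)) : skew_form := Subvs (dwedge_skew a b).

Lemma dwedgeE a b x y : vsval (dwedge a b) x y = a x * b y - a y * b x.
Proof. by rewrite /= !lfunE. Qed.

Lemma wedge_linearl y : linear (wedge^~ y).
Proof.
move=> c x z; apply/lfunP=> w.
by rewrite add_lfunE scale_lfunE !wedgeE linearP add_lfunE scale_lfunE.
Qed.

Lemma wedge_linearr x : linear (wedge x).
Proof.
move=> c y z; apply/lfunP=> w.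
by rewrite add_lfunE scale_lfunE !wedgeE linearP.
Qed.

Definition coord_form i (x : V) : F^o := coord (vbasis {:V}) i x.

Fact coord_form_is_linear i : linear (coord_form i).
Proof. by move=> c x y; rewrite /coord_form linearP. Qed.
HB.instance Definition _ i := GRing.isLinear.Build F V F^o _
  (coord_form i) (coord_form_is_linear i).

Let dual_basis i : 'Hom(V, F^o) := linfun (coord_form i).

Lemma wedge_expansion (k : ext2) :
  2%:R *: k = \sum_(i < \dim {:V}) \sum_(j < \dim {:V})
    (k (dwedge (dual_basis i) (dual_basis j)) : F) *:
    wedge (vbasis {:V})`_i (vbasis {:V})`_j.
Proof.
apply/lfunP=> w; rewrite scale_lfunE -linearZ sum_lfunE /=.
have -> : 2%:R *: w = \sum_(i < \dim {:V}) \sum_(j < \dim {:V})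
    (vsval w (vbasis {:V})`_i (vbasis {:V})`_j : F) *:
    dwedge (dual_basis i) (dual_basis j).
  apply: val_inj; apply/lfunP=> x; apply/lfunP=> y.
  have vw (a b : V) : vsval w a b = \sum_(i < \dim {:V}) \sum_(j < \dim {:V})
      vsval w (vbasis {:V})`_i (vbasis {:V})`_j
        * (dual_basis i a * dual_basis j b).
    rewrite {1}(coord_vbasis (memvf a)) linear_sum sum_lfunE.
    apply: eq_bigr => i _; rewrite linearZ scale_lfunE /=.
    rewrite {1}(coord_vbasis (memvf b)) linear_sum scaler_sumr.
    apply: eq_bigr => j _; rewrite linearZ /= !lfunE /= /coord_form.
    by rewrite [RHS]mulrC -[RHS]mulrA.
  rewrite linearZ /= !scale_lfunE scaler_nat mulr2n.
  have /skew_formsP/(_ x y) {2}-> := subvsP w.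
  rewrite (vw x y) (vw y x) -sumrB linear_sum !sum_lfunE.
  apply: eq_bigr => i _; rewrite -sumrB linear_sum !sum_lfunE.
  apply: eq_bigr => j _; rewrite [in RHS]linearZ !scale_lfunE dwedgeE.
  exact: esym (mulrBr _ _ _).
rewrite [LHS]linear_sum; apply: eq_bigr => i _; rewrite linear_sum sum_lfunE.
apply: eq_bigr => j _; rewrite linearZ scale_lfunE wedgeE.
exact: mulrC.
Qed.

Section Lift.

Variables (U : vectType F) (f : 'Hom(V, 'Hom(V, U))).

Definition fcoord_at k x y : F^o := coord (vbasis {:U}) k (f x y).

Fact fcoord_at_is_linear k x : linear (fcoord_at k x).
Proof. by move=> c y z; rewrite /fcoord_at !linearP. Qed.
HB.instance Definition _ k x := GRing.isLinear.Build F V F^o _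
  (fcoord_at k x) (fcoord_at_is_linear k x).

Definition fcomp_coord k x : 'Hom(V, F^o) := linfun (fcoord_at k x).

Fact fcomp_coord_is_linear k : linear (fcomp_coord k).
Proof.
move=> c x z; apply/lfunP=> y; rewrite add_lfunE scale_lfunE !lfunE /=.
by rewrite /fcoord_at linearP add_lfunE scale_lfunE linearP.
Qed.
HB.instance Definition _ k := GRing.isLinear.Build F V 'Hom(V, F^o) _
  (fcomp_coord k) (fcomp_coord_is_linear k).

Definition ext2_lift (ws : 'I_(\dim {:U}) -> skew_form) (k : ext2) : U :=
  \sum_(i < \dim {:U}) (k (ws i) : F) *: (vbasis {:U})`_i.

Fact ext2_lift_is_linear ws : linear (ext2_lift ws).
Proof.
move=> c k1 k2; rewrite /ext2_lift scaler_sumr -big_split; apply: eq_bigr => i _.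
by rewrite add_lfunE scale_lfunE scalerDl scalerA.
Qed.
HB.instance Definition _ ws := GRing.isLinear.Build F ext2 U _
  (ext2_lift ws) (ext2_lift_is_linear ws).

End Lift.

Hypothesis two_neq0 : 2%:R != 0 :> F.

Lemma wedge_alternating x : wedge x x = 0.
Proof.
apply/lfunP=> w; rewrite wedgeE zero_lfunE.
have /skew_formsP/(_ x x)/eqP := subvsP w.
by rewrite -addr_eq0 -mulr2n -mulr_natl mulf_eq0 (negPf two_neq0) => /eqP.
Qed.

Lemma ext2_universal (U : vectType F) (f : 'Hom(V, 'Hom(V, U))) :
    (forall x, f x x = 0) ->
  exists! g : 'Hom(ext2, U), forall x y, g (wedge x y) = f x y.
Proof.
move=> f_alt; pose u := vbasis {:U}.
have fN x y : f x y = - f y x.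
  apply/eqP; rewrite -addr_eq0; have := f_alt (x + y).
  by rewrite !linearD /= !add_lfunE !f_alt add0r addr0 addrC => ->.
pose fk k := linfun (fcomp_coord f k).
have fkE k x y : fk k x y = coord u k (f x y) by rewrite !lfunE.
have fk_skew k : fk k \in skew_forms.
  by apply/skew_formsP=> x y; rewrite !fkE fN linearN.
pose g := linfun (ext2_lift (fun k => Subvs (fk_skew k))).
have gE x y : g (wedge x y) = f x y.
  rewrite lfunE /= /ext2_lift [RHS](coord_vbasis (memvf _)).
  by apply: eq_bigr => k _; rewrite wedgeE /= fkE.
exists g; split=> // h hE; apply/lfunP=> k; apply: (scalerI two_neq0).
rewrite -!linearZ /= (wedge_expansion k) !linear_sum; apply: eq_bigr => i _.
rewrite !linear_sum; apply: eq_bigr => j _.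
by rewrite !linearZ /= gE hE.
Qed.

End ExteriorSquare.

Section Resonance.

Variables (F : fieldType) (V : vectType F).
Implicit Type K : {vspace ext2 V}.

(* An element k of ext2 V is a functional on skew forms, so k w is the value  *)
(* of the form w at k.                                                        *)
Definition perp K (w : skew_form V) : Prop := forall k, k \in K -> k w = 0.

Definition resonance K (a : 'Hom(V, F^o)) : Prop :=
  a = 0 \/ exists b : 'Hom(V, F^o), dwedge a b != 0 /\ perp K (dwedge a b).

Definition monomial_span n (v : n.-tuple V) (r : rel 'I_n) : {vspace ext2 V} :=
  (\sum_(i < n) \sum_(j < n | r i j) <[wedge (tnth v i) (tnth v j)]>)%VS.

Definition monomial K : Prop :=
  exists n (v : n.-tuple V) (r : rel 'I_n),
    basis_of {:V} v /\ K = monomial_span v r.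

End Resonance.

(* The vertices 1, 2, 3, 4 are represented by 0, 1, 2, 3. *)
Definition cycle4 : rel 'I_4 := fun i j =>
  let edges := [:: (0, 1); (1, 2); (2, 3); (0, 3)]%N in
  ((val i, val j) \in edges) || ((val j, val i) \in edges).

(* Main.v *)
(* R_Gamma lies in the union of the two coordinate planes P = <f0, f2> and
   Q = <f1, f3>, so f0 /\ f2 and f1 /\ f3 belong to the orthogonal of K.  Any
   other form w in that orthogonal can be corrected by multiples of these two
   so that its (0, 2) entry is 1 and its Pfaffian vanishes.  It then spans a
   plane of R(V, K) that meets P outside 0, hence equals P: so w itself vanishes
   on the edges of the cycle, and K and K_Gamma have the same orthogonal. *)
Require Import Defs.
From mathcomp Require Import all_boot all_order all_algebra.
From mathcomp Require Import ring.

Import GRing.Theory.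
Local Open Scope ring_scope.

(** * Separation by functionals and finite-dimensional reflexivity *)

Section Bipolar.

Set Implicit Arguments.
Unset Strict Implicit.

Variables (F : fieldType) (V : vectType F).

Lemma lfun_basis_ext (U : vectType F) n (v : n.-tuple V) (f g : 'Hom(V, U)) :
  basis_of {:V} v -> (forall i, f (tnth v i) = g (tnth v i)) -> f = g.
Proof.
move=> v_basis fg; apply/lfunP=> x.
rewrite (coord_basis v_basis (memvf x)) !linear_sum.
by apply: eq_bigr => i _; rewrite !linearZ /= -tnth_nth fg.
Qed.

(** The difference [p] of the identity and a projection onto K kills K but not x, so some coordinate
    of [p] separates x from K. *)
Lemma functional_separation (K : {vspace V}) (x : V) :
  x \notin K -> exists2 phi : 'Hom(V, F^o), forall y, y \in K -> phi y = 0
                                         & phi x != 0.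
Proof.
move=> xK; pose p : 'End(V) := \1%VF - projv K.
have pE y : p y = y - projv K y by rewrite !lfun_simp.
have px : p x != 0.
  by apply: contra xK; rewrite pE subr_eq0 => /eqP ->; apply: memv_proj.
have [i xi] : exists i, coord (vbasis {:V}) i (p x) != 0.
  apply/existsP; apply: contraNT px => /existsPn p0; apply/eqP.
  rewrite (coord_vbasis (memvf (p x))) big1 // => i _.
  by have /negPn/eqP -> := p0 i; rewrite scale0r.
exists (linfun (coord_form i) \o p)%VF => [y yK|]; rewrite comp_lfunE lfunE //=.
by rewrite pE projv_id // subrr linear0.
Qed.

(** Expanding f in the dual basis [c] shows that the vector with coordinates [phi (c i)] represents
    phi. *)
Lemma functional_eval (phi : 'Hom('Hom(V, F^o), F^o)) :
  exists x : V, forall f : 'Hom(V, F^o), phi f = f x.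
Proof.
pose b := vbasis {:V}; pose c i : 'Hom(V, F^o) := linfun (coord_form i).
exists (\sum_(i < \dim {:V}) (phi (c i) : F) *: b`_i) => f.
have -> : f = \sum_(i < \dim {:V}) (f b`_i : F) *: c i.
  apply/lfunP=> x; rewrite {1}(coord_vbasis (memvf x)) linear_sum sum_lfunE.
  by apply: eq_bigr => i _; rewrite linearZ scale_lfunE lfunE /= [LHS]mulrC.
rewrite linear_sum linear_sum; apply: eq_bigr => i _.
rewrite !linearZ /= sum_lfunE (bigD1 i) //= big1 => [|j ji].
  rewrite scale_lfunE lfunE /= /coord_form coord_free ?eqxx ?addr0.
    by rewrite [f _ *: 1]mulr1 [LHS]mulrC.
  exact: basis_free (vbasisP _).
rewrite scale_lfunE lfunE /= /coord_form coord_free ?scaler0.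
  by rewrite eq_sym (negPf ji) scaler0.
exact: basis_free (vbasisP _).
Qed.

End Bipolar.

(** * Orthogonals in the space of skew forms *)

Section Perp.

Set Implicit Arguments.
Unset Strict Implicit.

Variables (F : fieldType) (V : vectType F).
Implicit Types (K : {vspace ext2 V}) (w : skew_form V) (a b : 'Hom(V, F^o)).

(** Since [ext2 V] is a dual space, a functional separating an element of K' from K is evaluation at
    a skew form, which lies in the orthogonal of K but not in that of K'. *)
Lemma perp_sub K K' : (forall w, perp K w -> perp K' w) -> (K' <= K)%VS.
Proof.
move=> sKK'; apply/subvP=> k kK'; apply/negPn/negP => /functional_separation.
case=> phi phiK; have [w phiE] := functional_eval phi.
rewrite phiE (sKK' w) ?eqxx // => h hK.
by rewrite -phiE phiK.
Qed.

Lemma perpD K w w' : perp K w -> perp K w' -> perp K (w + w').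
Proof. by move=> Kw Kw' h hK; rewrite linearD /= Kw // Kw' // addr0. Qed.

Lemma perpZ K c w : perp K w -> perp K (c *: w).
Proof. by move=> Kw h hK; rewrite linearZ /= Kw // scaler0. Qed.

Lemma perp_monomial_span n (v : n.-tuple V) (r : rel 'I_n) w :
  perp (monomial_span v r) w <->
  forall i j, r i j -> vsval w (tnth v i) (tnth v j) = 0.
Proof.
split=> [Kw i j rij | w0 h /memv_sumP[h1 h1P ->]].
  rewrite -wedgeE; apply: Kw.
  by apply/(sumv_sup i) => //; apply/(sumv_sup j).
rewrite sum_lfunE big1 // => i _; have /memv_sumP[h2 h2P ->] := h1P i isT.
rewrite sum_lfunE big1 // => j rij; have /vlineP[c ->] := h2P j rij.
by rewrite scale_lfunE wedgeE w0 // scaler0.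
Qed.

Lemma vsval_skew w x y : vsval w x y = - vsval w y x.
Proof. by have /skew_formsP := subvsP w. Qed.

(** Wedging the combination with b gives s times a /\ b; when s = 0, wedging with a gives -t times
    it. *)
Lemma resonance_lincomb K a b (s t : F) :
  dwedge a b != 0 -> perp K (dwedge a b) -> resonance K (s *: a + t *: b).
Proof.
move=> ab0 Kab; have [-> | s0] := eqVneq s 0.
  have [-> | t0] := eqVneq t 0; first by left; rewrite !scale0r addr0.
  right; exists a; have -> : dwedge (0 *: a + t *: b) a = - t *: dwedge a b.
    apply: val_inj; apply/lfunP=> x; apply/lfunP=> y.
    rewrite linearZ !scale_lfunE !dwedgeE !(add_lfunE, scale_lfunE).
    by rewrite /GRing.scale /=; ring.
  by split; [rewrite scaler_eq0 oppr_eq0 negb_or t0 | apply: perpZ].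
right; exists b; have -> : dwedge (s *: a + t *: b) b = s *: dwedge a b.
  apply: val_inj; apply/lfunP=> x; apply/lfunP=> y.
  rewrite linearZ !scale_lfunE !dwedgeE !(add_lfunE, scale_lfunE).
  by rewrite /GRing.scale /=; ring.
by split; [rewrite scaler_eq0 negb_or s0 | apply: perpZ].
Qed.

Lemma skew_form_ext n (v : n.-tuple V) w w' :
    2%:R != 0 :> F -> basis_of {:V} v ->
    (forall i j : 'I_n, (i < j)%N ->
       vsval w (tnth v i) (tnth v j) = vsval w' (tnth v i) (tnth v j)) ->
  w = w'.
Proof.
move=> two0 v_basis ww'; apply: val_inj.
apply: (lfun_basis_ext v_basis) => i.
apply: (lfun_basis_ext v_basis) => j.
have [ij | ji | /val_inj ->] := ltngtP i j; first exact: ww'.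
  by rewrite vsval_skew [RHS]vsval_skew ww'.
have diag (u : skew_form V) : vsval u (tnth v j) (tnth v j) = 0.
  by rewrite -wedgeE wedge_alternating // zero_lfunE.
by rewrite !diag.
Qed.

End Perp.

(** The 4-cycle is the complete bipartite graph on the two parity classes. *)
Lemma cycle4E (i j : 'I_4) : cycle4 i j = (odd i != odd j).
Proof. by case: i j => [[|[|[|[|i]]]] ?] [[|[|[|[|j]]]] ?]. Qed.

Lemma same_parity_ord4 (i j l : 'I_4) :
  i != j -> odd i = odd j -> i != l -> j != l -> odd l != odd i.
Proof.
by case: i j l => [[|[|[|[|i]]]] ?] [[|[|[|[|j]]]] ?] [[|[|[|[|l]]]] ?] //=.
Qed.

(** * The resonance variety of the 4-cycle *)

Section Cycle4.

Set Implicit Arguments.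
Unset Strict Implicit.

Variables (F : fieldType) (V : vectType F) (e : 4.-tuple V).
Hypotheses (two_neq0 : 2%:R != 0 :> F) (e_basis : basis_of {:V} e).
Implicit Types (a b : 'Hom(V, F^o)) (i j : 'I_4).

Let K4 := monomial_span e cycle4.
Let ev a i : F := a (tnth e i).

(** Vanishing on the edges equates [ev a i * ev b j] with [ev a j * ev b i] across the parity
    classes. If a were nonzero somewhere in both classes, b would be a multiple of a. *)
Lemma resonance_cycle4 a :
  resonance K4 a -> exists p, forall i, odd i = p -> ev a i = 0.
Proof.
case=> [-> | [b [ab0 /perp_monomial_span K4ab]]].
  by exists true => i _; rewrite /ev zero_lfunE.
have abE i j : odd i != odd j -> ev a i * ev b j = ev a j * ev b i.
  by rewrite -cycle4E => /K4ab /eqP; rewrite dwedgeE subr_eq0 => /eqP.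
have [/existsP[i /andP[oi ai0]] | /existsPn odd0] :=
    boolP [exists i : 'I_4, odd i && (ev a i != 0)]; last first.
  by exists true => i oi; apply/eqP; have := odd0 i; rewrite oi negbK.
have [/existsP[j /andP[oj aj0]] | /existsPn even0] :=
    boolP [exists j : 'I_4, ~~ odd j && (ev a j != 0)]; last first.
  by exists false => j oj; apply/eqP; have := even0 j; rewrite oj negbK.
(* Each vertex is adjacent to i or to j, so b is proportional to a. *)
case/eqP: ab0; apply: (skew_form_ext two_neq0 e_basis) => x y _.
rewrite dwedgeE linear0 !zero_lfunE; apply/eqP.
rewrite subr_eq0 -/(ev a x) -/(ev a y) -/(ev b x) -/(ev b y).
pose c := ev b i / ev a i.
have cj : ev b j = c * ev a j.
  by apply: (mulfI ai0); rewrite abE ?oi ?(negPf oj) // /c; field.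
have bE (z : 'I_4) : ev b z = c * ev a z.
  have [oz | oz] := boolP (odd z); last first.
    by apply: (mulfI ai0); rewrite abE ?oi ?(negPf oz) // /c; field.
  by apply: (mulfI aj0); rewrite abE ?oz ?(negPf oj) // cj; ring.
by rewrite !bE; apply/eqP; ring.
Qed.

Definition dual_form i : 'Hom(V, F^o) := linfun (coord e i : V -> F^o).

Lemma dual_formE i j : dual_form i (tnth e j) = (i == j)%:R.
Proof.
by rewrite lfunE /= (tnth_nth 0) coord_free ?(basis_free e_basis) // eq_sym.
Qed.

Lemma dual_wedgeE i j x y :
  vsval (dwedge (dual_form i) (dual_form j)) (tnth e x) (tnth e y) =
  (i == x)%:R * (j == y)%:R - (i == y)%:R * (j == x)%:R.
Proof. by rewrite dwedgeE !dual_formE. Qed.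

Lemma dual_wedge_neq0 i j : i != j -> dwedge (dual_form i) (dual_form j) != 0.
Proof.
move=> ij; apply/eqP => /(congr1 (fun w : skew_form V => vsval w (tnth e i) (tnth e j))).
rewrite dual_wedgeE !eqxx (negPf ij) mul0r subr0 mulr1 linear0 !zero_lfunE.
by apply/eqP; rewrite oner_eq0.
Qed.

Lemma perp_dual_wedge i j :
  odd i = odd j -> perp K4 (dwedge (dual_form i) (dual_form j)).
Proof.
move=> oij; apply/perp_monomial_span => x y; rewrite cycle4E => oxy.
rewrite dual_wedgeE.
have [? | _] := eqVneq i x; have [? | _] := eqVneq j y;
  have [? | _] := eqVneq i y; have [? | _] := eqVneq j x; subst;
  by rewrite ?oij ?eqxx ?mul0r ?mulr0 ?subrr // in oxy *.
Qed.

(** * Subspaces with the same resonance as the 4-cycle *)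

Section SameResonance.

Variable K : {vspace ext2 V}.
Hypothesis resK : forall a, resonance K4 a <-> resonance K a.

Lemma resonance_cycle4_nz a i : resonance K a -> ev a i != 0 ->
  forall j, odd j != odd i -> ev a j = 0.
Proof.
move=> /resK/resonance_cycle4[p ap] ai0 j oij; apply: (ap).
have : odd i != p by apply: contra ai0 => /eqP/ap ->.
by move: oij; case: (odd i); case: (odd j); case: (p).
Qed.

(* The planes of decomposables of the orthogonal of K lie in the union of the
   two coordinate planes, so they are those planes. *)
Lemma perp_dual_wedge_resonance i j : i != j -> odd i = odd j ->
  perp K (dwedge (dual_form i) (dual_form j)).
Proof.
move=> ij oij.
have /resK[fi0 | [b [ib0 Kib]]] : resonance K4 (dual_form i).
- by right; exists (dual_form j); split; [apply: dual_wedge_neq0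
                                         | apply: perp_dual_wedge].
- have /eqP := dual_formE i i; rewrite fi0 zero_lfunE eqxx eq_sym.
  by rewrite oner_eq0.
have lcE s t x : ev (s *: dual_form i + t *: b) x = s * (i == x)%:R + t * ev b x.
  by rewrite /ev !(add_lfunE, scale_lfunE) dual_formE.
(* The coefficient [1 - ev b i] gives the combination the value 1 at i, so it vanishes on the other
   class, where it agrees with b. *)
have b_odd (x : 'I_4) : odd x != odd i -> ev b x = 0.
  move=> oxi; have Kc := resonance_lincomb (1 - ev b i) 1 ib0 Kib.
  have := resonance_cycle4_nz (i := i) Kc; rewrite lcE eqxx mulr1 mul1r subrK.
  move=> /(_ (oner_neq0 _) x oxi); rewrite lcE mul1r.
  by rewrite (_ : (i == x) = false) ?mulr0 ?add0r //; apply: contraNF oxi => /eqP->.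
(* The class of i is {i, j}, so b is a combination of the dual forms at i and j. *)
have wE : dwedge (dual_form i) b = ev b j *: dwedge (dual_form i) (dual_form j).
  apply: (skew_form_ext two_neq0 e_basis) => x y _.
  rewrite linearZ !scale_lfunE !dwedgeE !dual_formE -/(ev b x) -/(ev b y).
  have bE (z : 'I_4) : ev b z = ev b i * (i == z)%:R + ev b j * (j == z)%:R.
    have [<- | iz] := eqVneq i z.
      by rewrite eq_sym (negPf ij) mulr0 addr0 mulr1.
    have [-> | jz] := eqVneq j z; first by rewrite mulr0 add0r mulr1.
    by rewrite !mulr0 addr0; apply: b_odd; apply: same_parity_ord4 iz jz.
  by rewrite (bE x) (bE y) /GRing.scale /=; ring.
have bj0 : ev b j != 0 by apply: contra ib0; rewrite wE => /eqP->; rewrite scale0r.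
have -> : dwedge (dual_form i) (dual_form j) =
          (ev b j)^-1 *: dwedge (dual_form i) b.
  by rewrite wE scalerA mulVf // scale1r.
exact: perpZ.
Qed.

Let i0 := @Ordinal 4 0 isT.
Let i1 := @Ordinal 4 1 isT.
Let i2 := @Ordinal 4 2 isT.
Let i3 := @Ordinal 4 3 isT.

Let ord4 i : [\/ i = i0, i = i1, i = i2 | i = i3].
Proof.
case: i => [[|[|[|[|//]]]] i4];
  by [constructor 1; apply: val_inj | constructor 2; apply: val_inj
     | constructor 3; apply: val_inj | constructor 4; apply: val_inj].
Qed.

Lemma perp_resonance_cycle4 w : perp K w -> perp K4 w.
Proof.
move=> Kw; pose W i j : F := vsval w (tnth e i) (tnth e j).
have WN i j : W j i = - W i j by rewrite /W vsval_skew.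
have Wii i : W i i = 0 by rewrite /W -wedgeE wedge_alternating // zero_lfunE.
(* t makes the Pfaffian of u vanish, so that u is decomposable. *)
pose t := W i0 i1 * W i2 i3 + W i0 i3 * W i1 i2.
(* The correction sets the (0, 2) entry to 1 and the (1, 3) entry to [t], and leaves the entries on
   edges unchanged. *)
pose u := w + ((1 - W i0 i2) *: dwedge (dual_form i0) (dual_form i2)
              + (t - W i1 i3) *: dwedge (dual_form i1) (dual_form i3)).
have Ku : perp K u.
  by apply: perpD => //; apply: perpD; apply: perpZ; apply: perp_dual_wedge_resonance.
have uE x y : vsval u (tnth e x) (tnth e y) = W x y +
    ((1 - W i0 i2) * ((i0 == x)%:R * (i2 == y)%:R - (i0 == y)%:R * (i2 == x)%:R)
    + (t - W i1 i3) * ((i1 == x)%:R * (i3 == y)%:R - (i1 == y)%:R * (i3 == x)%:R)).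
  by rewrite /u !linearD !linearZ !(add_lfunE, scale_lfunE) !dual_wedgeE.
(* A skew form of zero Pfaffian with (0, 2) entry 1 is the wedge of its rows 0 and 2. *)
pose a := vsval u (tnth e i0); pose b := vsval u (tnth e i2).
have abE : dwedge a b = u.
  apply: (skew_form_ext two_neq0 e_basis) => x y xy.
  rewrite dwedgeE !uE; move: xy.
  case: (ord4 x) => ->; case: (ord4 y) => -> // _;
    by rewrite /= ?(WN i1 i2) ?(WN i0 i2) ?Wii /t; ring.
have a2 : ev a i2 = 1 by rewrite /ev uE /=; ring.
have b0 : ev b i0 = - 1 by rewrite /ev uE /= (WN i0 i2); ring.
have u0 : dwedge a b != 0.
  rewrite abE; apply/eqP => u0; have := oner_neq0 F.
  by rewrite -a2 /ev /a u0 linear0 !zero_lfunE eqxx.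
have Kab : perp K (dwedge a b) by rewrite abE.
(* Both a and b are nonzero at an even vertex, so they vanish at the odd ones; these four values
   are, up to sign, the entries of w on the edges. *)
have aP (x : 'I_4) : odd x -> ev a x = 0.
  move=> ox; apply: (@resonance_cycle4_nz a i2); rewrite ?a2 ?oner_neq0 ?ox //.
  by have := resonance_lincomb 1 0 u0 Kab; rewrite scale1r scale0r addr0.
have bP (x : 'I_4) : odd x -> ev b x = 0.
  move=> ox; apply: (@resonance_cycle4_nz b i0).
  - by have := resonance_lincomb 0 1 u0 Kab; rewrite scale1r scale0r add0r.
  - by rewrite b0 oppr_eq0 oner_neq0.
  - by rewrite ox.
have W01 : W i0 i1 = 0 by rewrite -(aP i1) // /ev uE /=; ring.
have W03 : W i0 i3 = 0 by rewrite -(aP i3) // /ev uE /=; ring.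
have W21 : W i2 i1 = 0 by rewrite -(bP i1) // /ev uE /=; ring.
have W23 : W i2 i3 = 0 by rewrite -(bP i3) // /ev uE /=; ring.
apply/perp_monomial_span => x y; rewrite -/(W x y).
case: (ord4 x) => ->; case: (ord4 y) => -> // _;
  by rewrite ?W01 ?W03 ?W21 ?W23 // WN ?W01 ?W03 ?W21 ?W23 oppr0.
Qed.

(** A form vanishing on the edges has only the entries at the two diagonals (0, 2) and (1, 3), and
    the corresponding dual wedges already lie in the orthogonal of K. *)
Lemma perp_cycle4_resonance w : perp K4 w -> perp K w.
Proof.
move=> /perp_monomial_span w0.
pose W i j : F := vsval w (tnth e i) (tnth e j).
have edge i j : cycle4 i j -> W i j = 0 by exact: w0.
have -> : w = W i0 i2 *: dwedge (dual_form i0) (dual_form i2)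
              + W i1 i3 *: dwedge (dual_form i1) (dual_form i3).
  apply: (skew_form_ext two_neq0 e_basis) => x y xy.
  rewrite linearD !linearZ !(add_lfunE, scale_lfunE) !dual_wedgeE -/(W x y).
  rewrite /GRing.scale /=; move: xy.
  case: (ord4 x) => ->; case: (ord4 y) => -> //= _;
    by rewrite ?(edge i0 i1, edge i1 i2, edge i2 i3, edge i0 i3) //; ring.
by apply: perpD; apply: perpZ; apply: perp_dual_wedge_resonance.
Qed.

Lemma resonance_cycle4_inj : K = K4.
Proof.
apply/eqP; rewrite eqEsubv; apply/andP; split; apply: perp_sub.
  exact: perp_cycle4_resonance.
exact: perp_resonance_cycle4.
Qed.

End SameResonance.

End Cycle4.

Theorem mainTheorem5 (k : closedFieldType) (char0 : [pchar k] =i pred0)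
    (V : vectType k) (e : 4.-tuple V) (e_basis : basis_of {:V} e) :
  ~ exists K : {vspace ext2 V},
      ~ monomial K /\
      (forall a : 'Hom(V, k^o),
         resonance (monomial_span e cycle4) a <-> resonance K a).
Proof.
case=> K [K_nonmonomial resK]; apply: K_nonmonomial.
have two_neq0 : 2%:R != 0 :> k by apply/negPf; have := char0 2; rewrite inE.
(* As K equals the subspace of the cycle, the given basis itself shows that K is monomial. *)
exists 4, e, cycle4; split=> //.
exact: (resonance_cycle4_inj two_neq0 e_basis resK).
Qed.
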